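(* Fix a real number $\epsilon$ with $0<\epsilon<1$ and integers $m\geq 2$ and $D\geq 3$. Then, up to isomorphism, there are only finitely many distance-regular graphs with smallest eigenvalue at least $-m$, diameter $D$, and intersection numbers $a_1,c_2$ satisfying $c_2\geq \epsilon a_1$.
   Context: A finite connected graph $\Gamma$ with diameter $D$ is distance-regular if there are integers $b_i,c_i$ ($0\le i\le D$) such that for any vertices $x,y$ with $d(x,y)=i$, exactly $c_i$ neighbours of $y$ are at distance $i-1$ from $x$ and exactly $b_i$ neighbours of $y$ are at distance $i+1$ from $x$; its valency is $k=b_0$ and $a_i:=k-b_i-c_i$. The smallest eigenvalue is that of the adjacency matrix. *)

(* Defs.v *)
From HB Require Import structures.
From mathcomp Require Import all_boot all_order all_algebra.
From mathcomp Require Import reals.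
Set Implicit Arguments. Unset Strict Implicit. Unset Printing Implicit Defensive.
Import Order.TTheory GRing.Theory Num.Theory.

Definition simple_graph (T : finType) (e : rel T) : Prop :=
  (forall x y, e x y = e y x) /\ (forall x, ~~ e x x).

Fixpoint ball (T : finType) (e : rel T) (n : nat) (x : T) : {set T} :=
  match n with
  | 0 => [set x]
  | n'.+1 => ball e n' x :|: [set z | [exists y in ball e n' x, e y z]]
  end.

Definition connected_graph (T : finType) (e : rel T) : Prop :=
  forall x y : T, exists n, y \in ball e n x.

(* graph distance (meaningful for connected graphs: distances are < #|T|) *)
Definition gdist (T : finType) (e : rel T) (x y : T) : nat :=
  find (fun n => y \in ball e n x) (iota 0 #|T|).

Definition has_diameter (T : finType) (e : rel T) (D : nat) : Prop :=
  (forall x y, gdist e x y <= D) /\ (exists x y, gdist e x y = D).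

Definition distance_regular (T : finType) (e : rel T) (D : nat)
    (b c : nat -> nat) : Prop :=
  [/\ simple_graph e, connected_graph e, has_diameter e D &
      forall x y : T, let i := gdist e x y in
        #|[set z | e y z & gdist e x z == i.+1]| = b i /\
        (0 < i -> #|[set z | e y z & gdist e x z == i.-1]| = c i)].

Definition adjmx (R : nzRingType) (T : finType) (e : rel T) : 'M[R]_#|T| :=
  (\matrix_(i, j) (e (enum_val i) (enum_val j))%:R)%R.

Definition isomorphic_to (T : finType) (e : rel T) (n : nat)
    (e' : 'I_n -> 'I_n -> bool) : Prop :=
  exists f : T -> 'I_n, bijective f /\ forall x y, e x y = e' (f x) (f y).

(* Main.v *)
(** Let A be the adjacency matrix, of valency k.  Since A + m I is positive
    semidefinite, Cauchy-Schwarz bounds [(sum_(y ~ x) g y)^2] by [m] times the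
    form at [g], for every [g] vanishing at a vertex x.  The indicator of the
    neighbourhood of x gives k <= m a_1 + m^2, so that c_2 is at least a
    constant fraction of k.  The difference of the indicators of Q and Y, where
    all of Q and none of Y is adjacent to x and Q is completely joined to Y,
    gives s <= 2 m^2 when |Q| = |Y| = s.  So the bipartite graph between the
    vertices at distance 1 and 2 from x contains no large biclique.  On the
    other hand D >= 3 provides at least c_2 vertices at distance 2 from some x,
    each with c_2 neighbours among the k neighbours of x; for large k so dense
    a bipartite graph contains a large biclique.  Hence k is bounded, and
    the number of vertices is at most (k+1)^D. *)
Require Import Defs.
From HB Require Import structures.
From mathcomp Require Import all_boot all_order all_algebra.
From mathcomp Require Import reals.
From mathcomp Require Import spectral sesquilinear complex.
From mathcomp Require Import ring zify.
Set Implicit Arguments. Unset Strict Implicit. Unset Printing Implicit Defensive.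
Import Order.TTheory GRing.Theory Num.Theory.

(** * Quadratic forms and the smallest eigenvalue *)

Section QuadraticForms.
Local Open Scope ring_scope.
Local Open Scope sesquilinear_scope.

(** Over [R[i]] the matrix is unitarily diagonalised with real diagonal [D]; in the coordinates [w]
    the two forms become the sums of [D 0 j * |w 0 j|^2] and of [|w 0 j|^2], compared term by
    term. *)
Lemma sym_form_ge (R : rcfType) n (A : 'M[R]_n) (l : R) :
  A^T = A -> (forall a, eigenvalue A a -> l <= a) ->
  forall v : 'rV[R]_n, l * (v *m v^T) 0 0 <= (v *m A *m v^T) 0 0.
Proof.
move=> Asym Aev v.
pose f : {rmorphism R -> R[i]} := real_complex R.
pose B : 'M[R[i]]_n := map_mx f A.
have conjf (x : R) : (f x)^* = f x by apply/CrealP/complex_realP; exists x.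
have Bsym : B \is symmetricmx.
  by apply/is_hermitianmxP; rewrite expr0 scale1r map_mx_id // map_trmx Asym.
have Breal : B \is a mxOver Num.real.
  by apply/mxOverP => i j; rewrite mxE; apply/complex_realP; exists (A i j).
have := orthomx_spectralP (symmetric_normalmx Bsym Breal).
set P := spectralmx B; set D := spectral_diag B => BE.
have PU : P \is unitarymx := spectral_unitarymx B.
have Punit := spectral_unit B.
have Dev j : exists2 d, D 0 j = f d & l <= d.
  have /mxOverP /(_ 0 j) /complex_realP [d Dd] :=
    hermitian_spectral_diag_real (realsym_hermsym Bsym Breal).
  exists d => //; apply: Aev.
  (* Eigenvalues descend from [B] to [A] through the characteristic polynomial; row [j] of the
     invertible [P] is an eigenvector of [B]. *)
  suff : eigenvalue B (f d).
    by rewrite !eigenvalue_root_char -map_char_poly fmorph_root.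
  apply/eigenvalueP; exists (row j P).
    rewrite -row_mul {1}BE !mulmxA mulmxV // mul1mx.
    by apply/rowP => i; rewrite mxE mul_diag_mx !mxE Dd.
  rewrite rowE; apply/eqP => /(congr1 (mulmx^~ (invmx P))).
  rewrite mulmxK // mul0mx => /rowP /(_ j) /eqP.
  by rewrite !mxE !eqxx oner_eq0.
pose u := map_mx f v; pose w := u *m P ^t*.
have ut : u ^t* = map_mx f v^T.
  by apply/matrixP => i j; rewrite !mxE conjf.
have wt : w ^t* = P *m u ^t* by rewrite trmx_mul map_mxM trmxCK.
have eA : f ((v *m A *m v^T) 0 0) = \sum_j D 0 j * `|w 0 j| ^+ 2.
  transitivity ((w *m diag_mx D *m w ^t*) 0 0).
    rewrite wt /w -(invmx_unitary PU) !mulmxA -2!(mulmxA u) -BE ut.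
    by rewrite -!map_mxM [RHS]mxE.
  rewrite mul_mx_diag mxE; apply: eq_bigr => j _.
  by rewrite !mxE normCK mulrAC mulrC mulrA.
have e1 : f ((v *m v^T) 0 0) = \sum_j `|w 0 j| ^+ 2.
  transitivity ((w *m w ^t*) 0 0).
    rewrite wt /w -(invmx_unitary PU) !mulmxA mulmxKV // ut.
    by rewrite -!map_mxM [RHS]mxE.
  by rewrite mxE; apply: eq_bigr => j _; rewrite !mxE normCK.
suff : f (l * (v *m v^T) 0 0) <= f ((v *m A *m v^T) 0 0) by rewrite lecR.
rewrite rmorphM /= e1 eA mulr_sumr; apply: ler_sum => j _.
have [d -> ld] := Dev j; rewrite ler_wpM2r ?exprn_ge0 ?normr_ge0 //.
by rewrite lecR.
Qed.

Lemma psd_cauchy_schwarz (R : realFieldType) n (M : 'M[R]_n) (i : 'I_n) :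
  M^T = M -> (forall v : 'rV[R]_n, 0 <= (v *m M *m v^T) 0 0) -> 0 < M i i ->
  forall v : 'rV[R]_n, (v *m M) 0 i ^+ 2 <= M i i * (v *m M *m v^T) 0 0.
Proof.
move=> Msym Mpsd Mi v; set s := (v *m M) 0 i.
pose d : 'rV[R]_n := delta_mx 0 i.
have vd : (v *m M *m d^T) 0 0 = s by rewrite trmx_delta -colE mxE.
have tr00 (B : 'M[R]_1) : B 0 0 = B^T 0 0 by rewrite mxE.
have dv : (d *m M *m v^T) 0 0 = s by rewrite tr00 !trmx_mul trmxK Msym mulmxA.
have dd : (d *m M *m d^T) 0 0 = M i i.
  by rewrite trmx_delta -colE mxE -rowE mxE.
(* Up to the factor [M i i], this is the part of [v] orthogonal to [d] for the form [M]. *)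
have := Mpsd (M i i *: v + (- s) *: d).
rewrite linearD !linearZ /= !(mulmxDl, mulmxDr) -!(scalemxAl, scalemxAr).
move: (v *m M *m d^T) (d *m M *m v^T) (d *m M *m d^T) (v *m M *m v^T) vd dv dd.
move=> X Y Z W X00 Y00 Z00; rewrite !mxE X00 Y00 Z00; set q := W 0 0.
rewrite (_ : _ + _ = M i i * (M i i * q - s ^+ 2)); last by ring.
by rewrite pmulr_rge0 // subr_ge0.
Qed.

(** Cauchy-Schwarz for A + l I against the basis vector of [x]. Its diagonal entries are [l] because
    there are no loops, and [g x = 0] removes the contribution of l I on the left. *)
Lemma adjacency_cauchy_schwarz (R : rcfType) (T : finType) (e : rel T) (l : R) :
  simple_graph e -> 0 < l -> (forall a, eigenvalue (adjmx R e) a -> - l <= a) ->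
  forall (x : T) (g : T -> R), g x = 0 ->
  (\sum_y (e x y)%:R * g y) ^+ 2 <=
  l * (\sum_y \sum_z g y * (e y z)%:R * g z + l * \sum_y g y ^+ 2).
Proof.
move=> [esym eirr] l0 ev x g gx0; set A := adjmx R e.
have Asym : A^T = A by apply/matrixP => i j; rewrite !mxE esym.
pose M := A + l%:M.
have Msym : M^T = M by rewrite linearD /= Asym tr_scalar_mx.
have ME (v : 'rV[R]_#|T|) :
    (v *m M *m v^T) 0 0 = (v *m A *m v^T) 0 0 + l * (v *m v^T) 0 0.
  rewrite mulmxDr mulmxDl mul_mx_scalar -scalemxAl.
  by move: (v *m A *m v^T) (v *m v^T) => X Y; rewrite !mxE.
have Mpsd (v : 'rV[R]_#|T|) : 0 <= (v *m M *m v^T) 0 0.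
  by rewrite ME -lerBlDr sub0r -mulNr; exact: sym_form_ge.
have Mii i : M i i = l by rewrite !mxE eqxx (negbTE (eirr _)) add0r.
pose v : 'rV[R]_#|T| := \row_i g (enum_val i).
have sumE (F : T -> R) : \sum_y F y = \sum_(i < #|T|) F (enum_val i).
  by rewrite (reindex_onto enum_val enum_rank) ?enum_valK //= => [|? _];
     [under eq_bigl => i do rewrite enum_valK eqxx | rewrite enum_rankK].
have := @psd_cauchy_schwarz R _ M (enum_rank x) Msym Mpsd _ v.
rewrite Mii => /(_ l0); rewrite ME.
suff -> : (v *m M) 0 (enum_rank x) = \sum_y (e x y)%:R * g y.
  suff -> : (v *m A *m v^T) 0 0 = \sum_y \sum_z g y * (e y z)%:R * g z.
    suff -> : (v *m v^T) 0 0 = \sum_y g y ^+ 2 by [].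
    by rewrite mxE sumE; apply: eq_bigr => i _; rewrite !mxE.
  rewrite exchange_big mxE sumE; apply: eq_bigr => i _.
  rewrite !mxE sumE mulr_suml; apply: eq_bigr => j _.
  by rewrite !mxE.
rewrite mulmxDr mul_mx_scalar mxE [X in _ + X]mxE [X in _ + _ * X]mxE.
rewrite enum_rankK gx0 mulr0 addr0 mxE sumE; apply: eq_bigr => i _.
by rewrite !mxE enum_rankK esym mulrC.
Qed.

(** Ordered pairs are counted, so for symmetric [e] an edge inside [A] counts twice in
    [edges e A A], as in the quadratic form. *)
Definition edges (T : finType) (e : rel T) (A B : {set T}) : nat :=
  (\sum_(y in A) \sum_(z in B) e y z)%N.

Lemma neighbour_cut_bound (R : rcfType) (T : finType) (e : rel T) (m : nat) :
  simple_graph e -> (0 < m)%N ->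
  (forall a : R, eigenvalue (adjmx R e) a -> - m%:R <= a) ->
  forall (x : T) (Q Y : {set T}), [disjoint Q & Y] -> x \notin Q -> x \notin Y ->
  (forall q, q \in Q -> e x q) -> (forall y, y \in Y -> ~~ e x y) ->
  (#|Q| ^ 2 + 2 * m * edges e Q Y <=
   m * (edges e Q Q + edges e Y Y + m * (#|Q| + #|Y|)))%N.
Proof.
move=> Gs m0 ev x Q Y dQY xQ xY eQ eY; have [esym eirr] := Gs.
pose ind (S : {set T}) y : R := (y \in S)%:R.
(* The cross terms of this test function give -2 [edges e Q Y], which the statement carries on the
   left to stay within [nat]. *)
pose g y := ind Q y - ind Y y.
have gx : g x = 0 by rewrite /g /ind (negbTE xQ) (negbTE xY) subrr.
have := adjacency_cauchy_schwarz Gs _ ev gx; rewrite ltr0n => /(_ m0).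
have sum_ind (F : T -> R) S : \sum_y ind S y * F y = \sum_(y in S) F y.
  rewrite [RHS]big_mkcond; apply: eq_bigr => y _.
  by rewrite /ind; case: (y \in S); rewrite ?mul1r ?mul0r.
have E0 : \sum_y (e x y)%:R * g y = #|Q|%:R.
  rewrite -sum1_card natr_sum -sum_ind; apply: eq_bigr => y _.
  rewrite /g /ind; case yQ: (y \in Q).
    by rewrite eQ // (disjointFr dQY yQ) subr0.
  case yY: (y \in Y); last by rewrite subrr mulr0 mul0r.
  by rewrite (negbTE (eY _ yY)) !mul0r.
have E1 S S' : \sum_y \sum_z ind S y * (e y z)%:R * ind S' z = (edges e S S')%:R.
  rewrite /edges natr_sum -sum_ind; apply: eq_bigr => y _.
  rewrite natr_sum -sum_ind mulr_sumr; apply: eq_bigr => z _.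
  by rewrite -mulrA [_ * ind S' z]mulrC.
have E2 : \sum_y \sum_z g y * (e y z)%:R * g z =
    (edges e Q Q)%:R + (edges e Y Y)%:R - 2%:R * (edges e Q Y)%:R.
  have QY : edges e Y Q = edges e Q Y.
    by rewrite /edges exchange_big; do 2!apply: eq_bigr => ? _; rewrite esym.
  rewrite mulr_natl mulr2n -{2}QY -!E1 opprD addrACA -!sumrN.
  rewrite -!big_split; apply: eq_bigr => y _; rewrite -!sumrN.
  by rewrite -!big_split; apply: eq_bigr => z _; rewrite /g /=; ring.
have E3 : \sum_y g y ^+ 2 = (#|Q| + #|Y|)%:R.
  rewrite natrD -!sum1_card !natr_sum -!sum_ind -big_split; apply: eq_bigr => y _.
  rewrite /g /ind; case yQ: (y \in Q); first by rewrite (disjointFr dQY yQ) /=; ring.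
  by case: (y \in Y) => /=; ring.
rewrite E0 E2 E3 => H.
rewrite -(ler_nat R) !(natrD, natrM, natrX) in H *; move: H.
set p := _ * (_ + _ - _ + _) => H; rewrite -lerBrDr; apply: le_trans H _.
by rewrite /p le_eqVlt; apply/orP; left; apply/eqP; ring.
Qed.

End QuadraticForms.

(** * Bicliques in dense bipartite graphs *)

Lemma subset_of_card (T : finType) (A : {set T}) s :
  s <= #|A| -> exists2 B : {set T}, B \subset A & #|B| = s.
Proof.
move=> sA; exists [set x in take s (enum A)].
  by apply/subsetP => x; rewrite inE => /mem_take; rewrite mem_enum.
by rewrite cardsE (card_uniqP _) ?take_uniq ?enum_uniq // size_takel // -cardE.
Qed.

Lemma dense_bipartite_biclique (T : finType) (r : rel T) (X Y : {set T}) d s :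
  0 < s -> (forall y, y \in Y -> d <= #|[set x in X | r x y]|) ->
  2 * s * #|X| <= #|Y| * d -> #|Y| * 2 ^ #|Y| < #|X| ->
  exists Q Z : {set T}, [/\ Q \subset X, Z \subset Y, #|Q| = s, #|Z| = s &
    forall q z, q \in Q -> z \in Z -> r q z].
Proof.
move=> s0 dY dense Xbig.
pose F x := [set y in Y | r x y].
pose good := [set x in X | s <= #|F x|].
have sumF : #|Y| * d <= \sum_(x in X) #|F x|.
  rewrite -sum_nat_const.
  have -> : \sum_(x in X) #|F x| = \sum_(y in Y) #|[set x in X | r x y]|.
    rewrite (eq_bigr (fun x => \sum_(y in Y) (r x y : nat))); last first.
      move=> x _; rewrite -sum1_card big_mkcond [RHS]big_mkcond.
      by apply: eq_bigr => y _; rewrite inE; case: (y \in Y) (r x y) => [] [].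
    rewrite exchange_big; apply: eq_bigr => y _.
    rewrite -sum1_card big_mkcond [RHS]big_mkcond.
    by apply: eq_bigr => x _; rewrite inE; case: (x \in X) (r x y) => [] [].
  exact: leq_sum.
(* A vertex outside [good] contributes less than [s], one inside at most [#|Y|]. *)
have sum_le : \sum_(x in X) #|F x| <= s * #|X| + #|Y| * #|good|.
  apply: (@leq_trans (\sum_(x in X) (s + #|Y| * (x \in good)))).
    apply: leq_sum => x xX; rewrite inE xX /=.
    have FY : #|F x| <= #|Y| by apply/subset_leq_card/subsetP => y /setIdP[].
    by case: leqP; lia.
  rewrite big_split /= sum_nat_const mulnC leq_add2l -big_distrr /= leq_mul2l.
  apply/orP; right; rewrite -sum1_card [leqRHS]big_mkcond [leqLHS]big_mkcond.
  by apply: leq_sum => x _; case: (x \in X); case: (x \in good).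
have good_big : s * #|X| <= #|Y| * #|good| by lia.
pose fiber Z := [set x in good | F x == Z].
(* Pigeonhole over the subsets of [Y]: [s] good vertices with the same neighbourhood [Z] give the
   biclique; otherwise [good] is too small for [good_big]. *)
have [/existsP[Z /andP[ZY sZ]]|] := boolP [exists Z in powerset Y, s <= #|fiber Z|].
  have [x0 x0Z] : exists x, x \in fiber Z by apply/card_gt0P; lia.
  have sZ' : s <= #|Z| by move: x0Z; rewrite !inE => /andP[/andP[_ ?]] /eqP <-.
  have [Q QZ sQ] := subset_of_card sZ; have [Z' Z'Z sZ''] := subset_of_card sZ'.
  exists Q, Z'; split=> //.
  - by apply: subset_trans QZ _; apply/subsetP => x; rewrite !inE => /andP[/andP[]].
  - by apply: subset_trans Z'Z _; rewrite -powersetE.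
  move=> q z /(subsetP QZ); rewrite inE => /andP[_ /eqP FqZ] /(subsetP Z'Z).
  by rewrite -FqZ inE => /andP[].
rewrite negb_exists => /forallP small.
have : #|good| <= 2 ^ #|Y| * s.
  rewrite -card_powerset -sum1_card -sum_nat_const.
  rewrite (partition_big F (mem (powerset Y))) /=; last first.
    by move=> x _; rewrite powersetE; apply/subsetP => y /setIdP[].
  apply: leq_sum => Z ZY; have := small Z; rewrite ZY /= -ltnNge => /ltnW.
  by rewrite -sum1_card; under eq_bigl => x do rewrite inE.
move=> good_small; suff : #|X| <= #|Y| * 2 ^ #|Y| by lia.
rewrite -(leq_pmul2l s0) (leq_trans good_big) // mulnCA leq_mul2l.
by rewrite [s * _]mulnC good_small orbT.
Qed.

(** * Consequences of the eigenvalue bound *)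

Section BoundedBelow.
Variables (R : rcfType) (T : finType) (e : rel T) (m : nat).
Hypotheses (Gs : simple_graph e) (m0 : 0 < m).
Hypothesis ev : forall a : R, eigenvalue (adjmx R e) a -> (- m%:R <= a)%R.

(** Bounding the edge counts inside [Q] and [Y] by s^2 turns the cut bound into s^2 + 2ms^2 <=
    m(2s^2 + 2ms), where 2ms^2 cancels. *)
Lemma biclique_bound (x : T) (Q Y : {set T}) s :
  #|Q| = s -> #|Y| = s -> x \notin Y ->
  (forall q, q \in Q -> e x q) -> (forall y, y \in Y -> ~~ e x y) ->
  (forall q y, q \in Q -> y \in Y -> e q y) -> s <= 2 * m ^ 2.
Proof.
move=> cQ cY xY eQ eY eQY.
have dQY : [disjoint Q & Y].
  by apply/pred0P => z /=; apply/negP => /andP[/eQ ez /eY]; rewrite ez.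
have xQ : x \notin Q by apply/negP => /eQ; case: Gs => _ /(_ x) /negP.
have edges_le (A B : {set T}) : edges e A B <= #|A| * #|B|.
  rewrite -sum_nat_const; apply: leq_sum => y _; rewrite -sum1_card.
  by apply: leq_sum => z _; case: (e y z).
have eQYE : edges e Q Y = s * s.
  rewrite -{1}cQ -sum_nat_const; apply: eq_bigr => q qQ.
  by rewrite -cY -sum1_card; apply: eq_bigr => y yY; rewrite eQY.
have := neighbour_cut_bound Gs m0 ev dQY xQ xY eQ eY.
have := edges_le Q Q; have := edges_le Y Y; rewrite eQYE cQ cY.
case: (posnP s) => [->//|s0] eYY eQQ H.
rewrite -(leq_pmul2l s0); nia.
Qed.

(** The cut bound for the neighbourhood of [x] and the empty set reads k^2 <= m(ka + mk). *)
Lemma valency_bound (x : T) k a :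
  #|[set y | e x y]| = k ->
  (forall y, e x y -> #|[set z | e x z & e y z]| <= a) ->
  k <= m * a + m ^ 2.
Proof.
move=> cQ ha; set Q := [set y | e x y] in cQ.
have xQ : x \notin Q by rewrite inE; case: Gs.
have eQQ : edges e Q Q <= k * a.
  rewrite -cQ -sum_nat_const; apply: leq_sum => y; rewrite inE => /ha.
  apply: leq_trans; rewrite -sum1_card big_mkcond [leqRHS]big_mkcond.
  by apply: leq_sum => z _; rewrite !inE; case: (e x z) (e y z) => [] [].
have e0 A : edges e A set0 = 0 by rewrite /edges big1 // => y _; rewrite big_set0.
have e0' A : edges e set0 A = 0 by rewrite /edges big_set0.
have := @neighbour_cut_bound _ _ _ _ Gs m0 ev x Q set0 _ xQ.
rewrite e0 e0' cards0 cQ => H.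
have {}H : k ^ 2 + 2 * m * 0 <= m * (edges e Q Q + 0 + m * (k + 0)).
  by apply: H => [||y|y]; rewrite -?setI_eq0 ?setI0 ?inE.
case: (posnP k) => [->//|k0].
rewrite -(leq_pmul2l k0); nia.
Qed.

End BoundedBelow.

(** * Balls and graph distance *)

Section Balls.
Variables (T : finType) (e : rel T).

Lemma ball_le i j (x : T) : i <= j -> ball e i x \subset ball e j x.
Proof.
move=> /subnK <-; elim: (j - i) => [|n IH] //=.
exact: subset_trans IH (subsetUl _ _).
Qed.

Lemma ball_step n (x y z : T) : y \in ball e n x -> e y z -> z \in ball e n.+1 x.
Proof. by move=> yB yz; rewrite !inE; apply/orP; right; apply/exists_inP; exists y. Qed.

Lemma ball_pred n (x z : T) : z \in ball e n.+1 x -> z \notin ball e n x ->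
  exists2 y, y \in ball e n x & e y z.
Proof. by rewrite !inE => /orP[->//|/exists_inP]. Qed.

Lemma ball_stable n (x : T) : ball e n.+1 x = ball e n x ->
  forall j, n <= j -> ball e j x = ball e n x.
Proof.
move=> stable j /subnK <-; elim: (j - n) => [|i IH] //=.
by rewrite -stable /= -IH.
Qed.

Lemma card_ball k (x : T) : (forall y, #|[set z | e y z]| <= k) ->
  forall n, #|ball e n x| <= k.+1 ^ n.
Proof.
move=> deg; elim=> [|n IH] /=; first by rewrite cards1.
set B := ball e n x in IH *.
have -> : [set z | [exists y in B, e y z]] = \bigcup_(y in B) [set z | e y z].
  apply/setP => z; rewrite inE; apply/exists_inP/bigcupP => -[y yB yz];
    by exists y; rewrite ?inE // in yz *.
apply: leq_trans (leq_card_setU _ _) _.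
suff : #|\bigcup_(y in B) [set z | e y z]| <= #|B| * k by rewrite expnS; nia.
rewrite -sum_nat_const; apply: (big_ind2 (fun (A : {set T}) n => #|A| <= n)) => //.
  by rewrite cards0.
by move=> A1 n1 A2 n2 le1 le2; apply: leq_trans (leq_card_setU _ _) (leq_add le1 le2).
Qed.

(* [gdist] takes the value #|T| on unreachable pairs, so a bound on it only
   says something below #|T|; graphs with at most D vertices are finite in
   number anyway. *)
Hypothesis gd : forall x y : T, gdist e x y < #|T|.

Lemma gdist_leE (x y : T) n : (gdist e x y <= n) = (y \in ball e n x).
Proof.
have := gd x y; rewrite /gdist => lt; set a := (fun n => _) in lt *.
have ha : has a (iota 0 #|T|) by rewrite has_find size_iota.
apply/idP/idP => [le|yB].
  by apply: (subsetP (ball_le x le)); have := nth_find 0 ha; rewrite nth_iota.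
rewrite leqNgt; apply/negP => lt'; have := before_find 0 lt'.
by rewrite nth_iota ?(ltn_trans lt') // /a add0n yB.
Qed.

Lemma gdist_eqSE (x y : T) n :
  (gdist e x y == n.+1) = (y \in ball e n.+1 x) && (y \notin ball e n x).
Proof. by rewrite -!gdist_leE; lia. Qed.

Lemma gdist_eq0E (x y : T) : (gdist e x y == 0) = (y == x).
Proof. by rewrite -leqn0 gdist_leE inE. Qed.

Lemma gdist_eq1E (x y : T) : (forall z, ~~ e z z) -> (gdist e x y == 1) = e x y.
Proof.
move=> eirr; rewrite gdist_eqSE !inE.
apply/andP/idP => [[/orP[->//|/exists_inP[z]]]|xy]; first by rewrite inE => /eqP->.
split; last by apply/eqP => yx; move: xy; rewrite yx (negbTE (eirr x)).
by apply/orP; right; apply/exists_inP; exists x; rewrite ?inE.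
Qed.

End Balls.

(** * Counting in distance-regular graphs *)

Section DistanceRegular.
Variables (T : finType) (e : rel T) (D : nat) (b c : nat -> nat).
Hypotheses (drg : distance_regular e D b c) (DT : D < #|T|).

Let esym x y : e x y = e y x. Proof. by case: drg => -[]. Qed.
Let eirr x : ~~ e x x. Proof. by case: drg => -[]. Qed.
Lemma drg_gdist_lt x y : gdist e x y < #|T|.
Proof. by case: drg => _ _ [gdD _] _; exact: leq_ltn_trans (gdD x y) DT. Qed.
Let gd := drg_gdist_lt.

Lemma drg_gdist1 x y : (gdist e x y == 1) = e x y.
Proof. exact: gdist_eq1E. Qed.
Let gd1 := drg_gdist1.

Lemma drg_valency x : #|[set y | e x y]| = b 0.
Proof.
have [_ _ _ /(_ x x)] := drg; have /eqP -> : gdist e x x == 0 by rewrite gdist_eq0E.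
by case=> <- _; apply: eq_card => z; rewrite !inE gd1 andbb.
Qed.

(** The neighbours of [y] at distances 2, 0 and 1 from [x] are disjoint sets; the first two have
    sizes [b 1] and [c 1]. *)
Lemma drg_common_nbrs_adj x y :
  e x y -> #|[set z | e x z & e y z]| <= b 0 - b 1 - c 1.
Proof.
move=> xy; have [_ _ _ /(_ x y)] := drg; have /eqP -> : gdist e x y == 1 by rewrite gd1.
case=> b1 /(_ isT) /= c1.
rewrite -(drg_valency y) -b1 -c1.
set A := [set z | _ & _ == 2]; set B := [set z | _ & _ == 0]; set C := [set z | _ & e y z].
suff : #|A| + #|B| + #|C| <= #|[set z | e y z]| by lia.
have AB : A :&: B = set0.
  by apply/setP => z; rewrite !inE; case: eqP => [->|]; rewrite !andbF.
have ABC : (A :|: B) :&: C = set0.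
  apply/setP => z; rewrite !inE -(gd1 x).
  by case: (gdist e x z) => [|[|[|?]]]; rewrite /= ?andbF.
rewrite -cardsUI AB cards0 addn0 -cardsUI ABC cards0 addn0.
apply: subset_leq_card; apply/subsetP => z; rewrite !inE.
by case/orP => [/orP[]|] /andP[].
Qed.

Lemma drg_common_nbrs_dist2 x y :
  gdist e x y = 2 -> #|[set z | e x z & e y z]| = c 2.
Proof.
move=> xy; have [_ _ _ /(_ x y)] := drg; rewrite xy => -[_ /(_ isT) /= <-].
by apply: eq_card => z; rewrite !inE gd1 andbC.
Qed.

Lemma drg_card_le : #|T| <= (b 0).+1 ^ D.
Proof.
have [_ _ [gdD [x _]] _] := drg.
have deg y : #|[set z | e y z]| <= b 0 by rewrite drg_valency.
apply: leq_trans (card_ball x deg D).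
rewrite -cardsT; apply/subset_leq_card/subsetP => y _.
by rewrite -gdist_leE.
Qed.

(* If d(x,z) = 3 and x ~ y with d(y,z) = 2, then the c_2 common neighbours
   of y and z are all at distance 2 from x. *)
Lemma drg_dist2_nbrs : 3 <= D ->
  exists (x : T) (S : {set T}), #|S| = c 2 /\ forall y, y \in S -> gdist e x y = 2.
Proof.
move=> D3; have [_ _ [_ [x [w xw]]] _] := drg.
(* Otherwise the balls around [x] are constant from radius 2 on, against d(x,w) = D >= 3. *)
have [z zB3 zB2] : exists2 z, z \in ball e 3 x & z \notin ball e 2 x.
  apply/subsetPn/negP => sub.
  have stable : ball e 3 x = ball e 2 x.
    by apply/eqP; rewrite eqEsubset sub ball_le.
  have := leqnn (gdist e x w); rewrite gdist_leE // xw.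
  by rewrite (ball_stable stable) ?(leq_trans _ D3) // -gdist_leE // xw; lia.
have [y2 y2B y2z] := ball_pred zB3 zB2.
have y2B1 : y2 \notin ball e 1 x by apply: contra zB2 => /ball_step; apply.
have [y1 y1B y1y2] := ball_pred y2B y2B1.
have y1z : gdist e y1 z = 2.
  apply/eqP; rewrite gdist_eqSE //; apply/andP; split.
    by apply: ball_step y2z; apply: ball_step y1y2; rewrite inE.
  rewrite -gdist_leE // leq_eqVlt gd1 ltnS leqn0 gdist_eq0E // negb_or.
  apply/andP; split; first by apply: contra zB2 => /(ball_step y1B).
  by apply: contra zB2 => /eqP ->; apply: (subsetP (ball_le e x _)) y1B.
exists x, [set y | e y1 y & e z y]; split; first exact: drg_common_nbrs_dist2.
move=> y; rewrite inE => /andP[y1y zy]; apply/eqP; rewrite gdist_eqSE //.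
rewrite (ball_step y1B y1y); apply: contra zB2 => yB.
by apply: ball_step yB _; rewrite esym.
Qed.

End DistanceRegular.

(* [s] exceeds the largest possible biclique; [N] vertices, each adjacent to a
   fraction 1/(2mE) of the k neighbours of x, force one of size [s] as soon as
   k > N 2^N. *)
Definition valency_cap (m E : nat) : nat :=
  let s := (2 * m ^ 2).+1 in let N := 2 * s * (2 * m * E) in
  2 * m ^ 2 + 2 * m * E * N + N * 2 ^ N.

Lemma drg_valency_le (R : rcfType) (T : finType) (e : rel T) (D m E : nat) b c :
  distance_regular e D b c -> D < #|T| -> 3 <= D -> 0 < m ->
  (forall a : R, eigenvalue (adjmx R e) a -> (- m%:R <= a)%R) ->
  b 0 - b 1 - c 1 <= E * c 2 -> b 0 <= valency_cap m E.
Proof.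
move=> drg DT D3 m0 ev a1c2; have [Gs _ _ _] := drg.
rewrite /valency_cap; set s := (2 * m ^ 2).+1; set N := 2 * s * (2 * m * E).
rewrite leqNgt; apply/negP => big.
have [x [S [cS S2]]] := drg_dist2_nbrs drg DT D3.
have kle := valency_bound Gs m0 ev (drg_valency drg DT x)
  (@drg_common_nbrs_adj _ _ _ _ _ drg DT x).
(* Since k > 2m^2, the term m^2 in [kle] is below k/2. *)
have kc2 : b 0 <= 2 * m * E * c 2 by nia.
(* The summand 2mEN of the cap is below k <= 2mE [c 2]. *)
have Nc2 : N <= #|S| by rewrite cS; nia.
have [Y YS cY] := subset_of_card Nc2.
have Yc y : y \in Y -> c 2 <= #|[set z in [set z | e x z] | e z y]|.
  move=> /(subsetP YS) /S2 /(drg_common_nbrs_dist2 drg DT) <-.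
  by apply/subset_leq_card/subsetP => z; rewrite !inE [e z y]Gs.1.
have [||Q [Z [QX ZY cQ cZ QZ]]] := @dense_bipartite_biclique _ e _ Y (c 2) s isT Yc.
- by rewrite (drg_valency drg DT) cY /N -(mulnA (2 * s)) leq_mul2l kc2 orbT.
- by rewrite (drg_valency drg DT) cY; lia.
suff : s <= 2 * m ^ 2 by rewrite ltnn.
have gd := drg_gdist_lt drg DT.
apply: (@biclique_bound R _ e m Gs m0 ev x Q Z s) => //.
- by apply/negP => /(subsetP ZY) /(subsetP YS) /S2 xx; have := gdist_eq0E gd x x; rewrite xx eqxx.
- by move=> q /(subsetP QX); rewrite inE.
- move=> y /(subsetP ZY) /(subsetP YS) /S2 d2.
  by rewrite -(drg_gdist1 drg DT) d2.
Qed.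

(** Finite functions on pairs make this a [finType], whose enumeration is the finite list of graphs
    sought. *)
Definition small_graph (V : nat) : finType :=
  {n : 'I_V.+1 & {ffun 'I_n * 'I_n -> bool}}.

Definition graph_of_small V (u : small_graph V) : {n : nat & 'I_n -> 'I_n -> bool} :=
  existT _ (tag u : nat) (fun a b => tagged u (a, b)).

Lemma isomorphic_to_small (T : finType) (e : rel T) V : #|T| <= V ->
  exists u : small_graph V, isomorphic_to e (projT2 (graph_of_small u)).
Proof.
move=> TV; pose n : 'I_V.+1 := Ordinal (TV : #|T| < V.+1).
pose F : {ffun 'I_n * 'I_n -> bool} :=
  [ffun p => e (enum_val (p.1 : 'I_#|T|)) (enum_val (p.2 : 'I_#|T|))].
exists (Tagged (fun n : 'I_V.+1 => {ffun 'I_n * 'I_n -> bool}) F), (@enum_rank T).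
split=> [|x y]; first exact: enum_rank_bij.
by rewrite /= ffunE /= !enum_rankK.
Qed.

Local Open Scope ring_scope.

Theorem theorem3p3 (R : realType) (eps : R) (m D : nat) :
  0 < eps < 1 -> (2 <= m)%N -> (3 <= D)%N ->
  exists (N : nat) (G : 'I_N -> {n : nat & 'I_n -> 'I_n -> bool}),
    forall (T : finType) (e : rel T) (b c : nat -> nat),
      distance_regular e D b c ->
      (forall a : R, eigenvalue (adjmx R e) a -> - (m%:R) <= a) ->
      eps * ((b 0%N - b 1%N - c 1%N)%N)%:R <= (c 2%N)%:R ->
      exists i : 'I_N, isomorphic_to e (projT2 (G i)).
Proof.
move=> /andP[eps0 _] m2 D3.
(* An integer above 1/eps turns the hypothesis on [c 2] into a_1 <= E [c 2]. *)
pose E := Num.bound eps^-1.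
(* Orders at most [D] are absorbed by the maximum; beyond them [D < #|T|] keeps distances below the
   default value of [gdist]. *)
pose V := maxn D ((valency_cap m E).+1 ^ D)%N.
exists #|small_graph V|, (fun i => graph_of_small (enum_val i)).
move=> T e b c drg ev a1c2.
suff /(isomorphic_to_small e) [u] : (#|T| <= V)%N.
  by move=> isou; exists (enum_rank u); rewrite enum_rankK.
rewrite leq_max; case: leqP => //= DT.
have m0 : (0 < m)%N by exact: ltnW.
apply: leq_trans (drg_card_le drg DT) _.
rewrite leq_exp2r ?ltnS; last by lia.
apply: drg_valency_le drg DT D3 m0 ev _.
rewrite -(ler_nat R) natrM; set a1 := _%:R in a1c2 *.
have : a1 <= eps^-1 * (c 2%N)%:R by rewrite mulrC ler_pdivlMr // mulrC.
move=> /le_trans; apply; rewrite ler_wpM2r // ltW //.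
by rewrite archi_boundP // invr_ge0 ltW.
Qed.
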